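(* Let $(X_n,d_n)$ be a sequence of compact metric spaces, let $f\colon[0,+\infty)\to[0,+\infty)$ be a locally Lipschitz function, and define the costs $c_n(x,y)=f(d_n(x,y))$ on $X_n\times X_n$. Suppose that $(X_n\times X_n,c_n)$ is an NNCC space for each $n\ge0$ and that $(X_n,d_n)$ converges to a compact metric space $(Z,d_Z)$ in the Gromov--Hausdorff topology. Then $(Z\times Z,f(d_Z))$ is an NNCC space.
   Context: For sets $X,Y$ and a (here finite) cost $c\colon X\times Y\to\mathbb R$, a pair $(\mathrm x,\bar y)$ with $\mathrm x\colon[0,1]\to X$ an arbitrary function (no continuity required) and $\bar y\in Y$ is a variational c-segment if for all $s\in(0,1)$ and $y\in Y$, $$c(\mathrm x(s),\bar y)-c(\mathrm x(s),y)\le (1-s)[c(\mathrm x(0),\bar y)-c(\mathrm x(0),y)]+s[c(\mathrm x(1),\bar y)-c(\mathrm x(1),y)].$$ $(X\times Y,c)$ is an NNCC space if for every $(x_0,x_1,\bar y)\in X\times X\times Y$ there exists a variational c-segment $(\mathrm x,\bar y)$ with $\mathrm x(0)=x_0$ and $\mathrm x(1)=x_1$. Gromov--Hausdorff distance: a correspondence between sets $X$ and $Y$ is a subset $R\subset X\times Y$ such that each $x\in X$ is in relation with some $y\in Y$ and each $y\in Y$ is in relation with some $x\in X$. For compact metric spaces $(X,d_X)$, $(Y,d_Y)$, the distance is the infimum over correspondences $R$ of $\sup\{|d_X(x,x')-d_Y(y,y')| : (x,y)\in R,\ (x',y')\in R\}$. *)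

(* Defs.v *)
From HB Require Import structures.
From mathcomp Require Import all_boot all_order all_algebra.
From mathcomp Require Import all_classical all_reals all_analysis.

Set Implicit Arguments.
Unset Strict Implicit.
Unset Printing Implicit Defensive.

Import Order.TTheory GRing.Theory Num.Theory.
Import numFieldNormedType.Exports.

Local Open Scope classical_set_scope.
Local Open Scope ring_scope.

(* A curve [0, 1] -> X is encoded as a function R -> X; only its values on
   [0, 1] are ever used, and every function on [0, 1] extends to R. *)
Definition variational_csegment (R : realType) (X Y : Type) (c : X -> Y -> R)
    (x : R -> X) (ybar : Y) : Prop :=
  forall (s : R) (y : Y), 0 < s < 1 ->
    c (x s) ybar - c (x s) y <=
      (1 - s) * (c (x 0) ybar - c (x 0) y) + s * (c (x 1) ybar - c (x 1) y).

Definition NNCC (R : realType) (X Y : Type) (c : X -> Y -> R) : Prop :=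
  forall (x0 x1 : X) (ybar : Y),
    exists x : R -> X, [/\ variational_csegment c x ybar, x 0 = x0 & x 1 = x1].

Definition correspondence (X Y : Type) (r : set (X * Y)) : Prop :=
  (forall x, exists y, r (x, y)) /\ (forall y, exists x, r (x, y)).

(* The supremum is taken in [0, +oo]: the maximum with 0 only matters for the
   empty relation, where ereal_sup set0 = -oo. *)
Definition distortion (R : realType) (X Y : metricType R) (r : set (X * Y)) :
    \bar R :=
  maxe 0%E (ereal_sup
    [set `|mdist p.1 q.1 - mdist p.2 q.2|%:E | p in r & q in r]).

Definition GH_dist (R : realType) (X Y : metricType R) : \bar R :=
  ereal_inf [set distortion r | r in @correspondence X Y].

(* Main.v *)
Require Import Defs.
From mathcomp Require Import all_boot all_order all_algebra.
From mathcomp Require Import all_classical all_reals all_analysis.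
Import Order.TTheory GRing.Theory Num.Theory.
Import numFieldNormedType.Exports.

Set Implicit Arguments.
Unset Strict Implicit.
Unset Printing Implicit Defensive.

Local Open Scope classical_set_scope.
Local Open Scope ring_scope.

(** The defining inequality of a variational c-segment constrains each value
    [x s] separately, since no continuity in [s] is required. So it suffices to
    fix [z0], [z1], [ybar] in [Z] and [s] in ]0, 1[, and to find one point [z]
    of [Z] for which the inequality at [s] holds against all [y].

    A correspondence of distortion at most [e] between some [X n] and [Z] moves
    this problem to [X n]: pick a partner in [X n] of every point of [Z], take
    there a c-segment between the partners of [z0] and [z1], and move its point
    at [s] back to a partner [z] in [Z]. The c-segment inequality is then an
    exact inequality between values of [f] at distances of [X n], each of which
    is within [e] of the corresponding distance in [Z]
    ([NNCC_approx_csegment_point]).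

    The point [z] depends on [e]; compactness of [Z] provides a single [z] that
    works for every [e > 0], since replacing the point by one at distance [d]
    costs only [d] in the precision ([compact_approx_csegment_point]). Letting
    [e] tend to 0 with [z] and [y] fixed, the distances of [X n] tend to those
    of [Z], and continuity of [f] at each point of [0, +oo[ carries the
    inequality to the limit ([near_dist_cvg]). *)

(** The hypothesis gives a Lipschitz estimate near each point of [A `*` A];
    at the diagonal point [(a, a)], freezing one variable at [a] turns it into
    continuity at [a]. *)
Lemma locally_lipschitz_cvg_within (K : numFieldType) (V W : normedModType K)
    (A : set V) (f : V -> W) :
  [locally [lipschitz f x | x in A]] ->
  forall a, A a -> f x @[x --> within A (nbhs a)] --> f a.
Proof.
move=> f_lip a Aa; apply/cvgrPdist_lt => e e0.
have [M [M0 fM]] : exists M, 0 < M /\ within (A `*` A) (nbhs (a, a))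
    [set x | `|f x.1 - f x.2| <= M * `|x.1 - x.2|].
  have lip_aa := f_lip (a, a) (conj Aa Aa).
  near (+oo : set_system K) => M.
  by exists M; split; near: M => //; exact: nbhs_pinfty_gt.
have diag_cvg : (a, x) @[x --> a] --> (a, a).
  by apply: (@cvg_pair _ _ _ (nbhs a) (nbhs a) (nbhs a));
    [exact: cvg_cst|exact: cvg_id].
have fMa : \forall x \near a, A x -> `|f a - f x| <= M * `|a - x|.
  have fM_diag : \forall x \near a, (A `*` A) (a, x) ->
      `|f a - f x| <= M * `|a - x| := diag_cvg _ fM.
  by apply: filterS fM_diag => x fMx Ax; exact: fMx.
have : \forall x \near a, `|a - x| < M^-1 * e.
  by apply: (cvgr_dist_lt id _ cvg_id); rewrite mulr_gt0// invr_gt0.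
rewrite /within/=; apply: filterS2 fMa => x fMx ax Ax.
rewrite (le_lt_trans (fMx Ax))// -(ltr_pM2l (x := M^-1)) ?invr_gt0//.
by rewrite mulKf ?gt_eqF.
Unshelve. all: by end_near. Qed.

Lemma distortion_le (R : realType) (X Y : metricType R) (r : set (X * Y))
    e p q :
  (distortion r <= e%:E)%E -> r p -> r q ->
  `|mdist p.1 q.1 - mdist p.2 q.2| <= e.
Proof.
rewrite /distortion ge_max => /andP[_ re] rp rq; rewrite -lee_fin.
by apply: le_trans re; apply: ereal_sup_ubound; exists p => //; exists q.
Qed.

Lemma cvg_GH_dist0_correspondence (R : realType) (X : nat -> metricType R)
    (Z : metricType R) :
  GH_dist (X n) Z @[n --> \oo] --> 0%E ->
  forall e, 0 < e -> exists n, exists2 r : set (X n * Z),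
    correspondence r & (distortion r <= e%:E)%E.
Proof.
move=> X_cvg e e0.
have /X_cvg[N _ /(_ N (leqnn N)) /=] :
    nbhs (0%E : \bar R) [set x | (x < e%:E)%E].
  apply: open_nbhs_nbhs; split; first exact: open_ereal_lt_ereal.
  by rewrite /= lte_fin.
by move=> /ereal_inf_lt[_ [r rc <-] re]; exists N, r => //; exact: ltW.
Qed.

(** The function [g] stands for the distances, measured in a nearby space, from
    a partner of [z] to chosen partners of the points of [Z]. Nonnegativity is
    recorded because [f] is controlled on [0, +oo[ only. *)
Definition near_dist (R : realType) (Z : metricType R) (e : R) (z : Z)
    (g : Z -> R) : Prop :=
  forall y, 0 <= g y /\ `|mdist z y - g y| <= e.

(** The error [e] is allowed in the distances, while the inequality between the
    values of [f] is kept exact: this makes the notion independent of any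
    modulus of continuity of [f]. *)
Definition approx_csegment_point (R : realType) (Z : metricType R) (f : R -> R)
    (z0 z1 ybar : Z) (s e : R) (z : Z) : Prop :=
  exists g0 g1 g : Z -> R,
    [/\ near_dist e z0 g0, near_dist e z1 g1, near_dist e z g &
      forall y, f (g ybar) - f (g y) <=
        (1 - s) * (f (g0 ybar) - f (g0 y)) + s * (f (g1 ybar) - f (g1 y))].

(** Partners [sigma] of the points of [Z] are chosen once and for all, and the
    approximate distances are those of [X] to the points [sigma y]. *)
Lemma NNCC_approx_csegment_point (R : realType) (X Z : metricType R)
    (f : R -> R) (r : set (X * Z)) (e : R) :
  NNCC (fun x y : X => f (mdist x y)) ->
  correspondence r -> (distortion r <= e%:E)%E ->
  forall (z0 z1 ybar : Z) (s : R), 0 < s < 1 ->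
    exists z, approx_csegment_point f z0 z1 ybar s e z.
Proof.
move=> X_NNCC [rX rZ] re z0 z1 ybar s s01.
have [sigma rsigma] := choice rZ.
have [x [x_seg x0 x1]] := X_NNCC (sigma z0) (sigma z1) (sigma ybar).
have [z rz] := rX (x s).
have near_sigma a b : r (a, b) -> near_dist e b (fun y => mdist a (sigma y)).
  move=> rab y; split; first exact: mdist_ge0.
  by rewrite distrC; exact: (distortion_le re rab (rsigma y)).
exists z, (fun y => mdist (sigma z0) (sigma y)),
  (fun y => mdist (sigma z1) (sigma y)), (fun y => mdist (x s) (sigma y)).
split; [exact: near_sigma..|move=> y].
by have := x_seg s (sigma y) s01; rewrite x0 x1.
Qed.

(** A cluster point of points of precision [1 / (k + 1)] has every precision
    [e]: infinitely many of these points lie within [e / 2] of it, and one of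
    them has precision at least as good as [e / 2]. *)
Lemma compact_approx_csegment_point (R : realType) (Z : metricType R)
    (f : R -> R) (z0 z1 ybar : Z) (s : R) :
  compact [set: Z] ->
  (forall e, 0 < e -> exists z, approx_csegment_point f z0 z1 ybar s e z) ->
  exists z, forall e, 0 < e -> approx_csegment_point f z0 z1 ybar s e z.
Proof.
move=> Z_compact approx.
have /choice[u u_approx] (k : nat) :
    exists z, approx_csegment_point f z0 z1 ybar s k.+1%:R^-1 z.
  by apply: approx; rewrite invr_gt0.
have [z [_ z_cluster]] := Z_compact (u k @[k --> \oo]) _ filterT.
exists z => e e0.
have e20 : 0 < e / 2 by rewrite divr_gt0.
have u_close : (u k @[k --> \oo]) (u @` [set k | k.+1%:R^-1 < e / 2]).
  by apply: filterS (near_infty_natSinv_lt (PosNum e20)) => k ke; exists k.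
have [_ [[k ke <-]]] := z_cluster _ _ u_close (nbhsx_ballx z _ e20).
rewrite ballEmdist /= => zu.
have near_e w v g : mdist w v < e / 2 -> near_dist k.+1%:R^-1 v g ->
    near_dist e w g.
  move=> wv vg y; have [g0 vgy] := vg y; split => //.
  have wvy : `|mdist w y - mdist v y| <= mdist w v.
    rewrite ler_distl; apply/andP; split.
      by rewrite lerBlDr (le_trans (metric_triangle v w y))// metric_sym addrC.
    by rewrite addrC; exact: metric_triangle.
  rewrite (le_trans (ler_distD (mdist v y) _ _))// [leRHS]splitr lerD//.
    by rewrite (le_trans wvy)// ltW.
  by rewrite (le_trans vgy)// ltW.
have [g0 [g1 [g [n0 n1 n ineq]]]] := u_approx k.
exists g0, g1, g; split => //.
- by apply: near_e n0; rewrite mdistxx.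
- by apply: near_e n1; rewrite mdistxx.
- exact: near_e n.
Qed.

Lemma near_dist_cvg (R : realType) (Z : metricType R) (f : R -> R) (z y : Z)
    (g : nat -> Z -> R) :
  (forall t : R, 0 <= t ->
    f x @[x --> within `[0, +oo[%classic (nbhs t)] --> f t) ->
  (forall k, near_dist k.+1%:R^-1 z (g k)) ->
  f (g k y) @[k --> \oo] --> f (mdist z y).
Proof.
move=> f_cvg gz.
have g_cvg : g k y @[k --> \oo] --> mdist z y.
  apply/cvgrPdist_lt => e e0.
  apply: filterS (near_infty_natSinv_lt (PosNum e0)) => k /=.
  by apply: le_lt_trans; have [] := gz k y.
have g_within : g k y @[k --> \oo] -->
    within `[0, +oo[%classic (nbhs (mdist z y)).
  move=> A wA.
  have gA : \forall k \near \oo, `[0, +oo[%classic (g k y) -> A (g k y) :=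
    g_cvg _ wA.
  apply: filterS gA => k; apply.
  by rewrite /= in_itv/= andbT; have [] := gz k y.
exact: cvg_comp g_within (f_cvg _ (mdist_ge0 z y)).
Qed.

Theorem theorem1p4 (R : realType) (X : nat -> metricType R) (Z : metricType R)
    (f : R -> R)
    (f_ge0 : forall t, 0 <= t -> 0 <= f t)
    (f_lip : [locally [lipschitz (f : R^o -> R^o) t | t in `[0, +oo[%classic]])
    (X_compact : forall n, compact [set: X n])
    (Z_compact : compact [set: Z])
    (X_NNCC : forall n, NNCC (fun x y : X n => f (mdist x y)))
    (X_cvg : GH_dist (X n) Z @[n --> \oo] --> 0%E) :
  NNCC (fun x y : Z => f (mdist x y)).
Proof.
have f_cvg (t : R) : 0 <= t ->
    f x @[x --> within `[0, +oo[%classic (nbhs t)] --> f t.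
  move=> t0; apply: (locally_lipschitz_cvg_within f_lip).
  by rewrite /= in_itv/= t0.
move=> z0 z1 ybar.
have /choice[z z_approx] (s : R) : exists z, 0 < s < 1 ->
    forall e, 0 < e -> approx_csegment_point f z0 z1 ybar s e z.
  have [s01|_] := boolP (0 < s < 1); last by exists z0.
  have [z zP] : exists z, forall e, 0 < e ->
      approx_csegment_point f z0 z1 ybar s e z.
    apply: compact_approx_csegment_point => // e e0.
    have [n [r r_corr re]] := cvg_GH_dist0_correspondence X_cvg e0.
    exact: NNCC_approx_csegment_point (X_NNCC n) r_corr re _ _ _ _ s01.
  by exists z.
(* The chosen points [z s] are meaningful for [s] in ]0, 1[ only, so the end
   points have to be set by hand. *)
exists (fun s => if s == 0 then z0 else if s == 1 then z1 else z s).
split; last 2 first.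
- by rewrite eqxx.
- by rewrite oner_eq0 eqxx.
move=> s y s01 /=; rewrite eqxx oner_eq0 eqxx.
have /andP[s_gt0 s_lt1] := s01; rewrite gt_eqF// lt_eqF//.
have /choice[g0 /choice[g1 /choice[g gP]]] (k : nat) :
    approx_csegment_point f z0 z1 ybar s k.+1%:R^-1 (z s).
  by apply: z_approx => //; rewrite invr_gt0.
have g0_near k : near_dist k.+1%:R^-1 z0 (g0 k) by have [] := gP k.
have g0_cvg w := near_dist_cvg (y := w) f_cvg g0_near.
have g1_near k : near_dist k.+1%:R^-1 z1 (g1 k) by have [] := gP k.
have g1_cvg w := near_dist_cvg (y := w) f_cvg g1_near.
have g_near k : near_dist k.+1%:R^-1 (z s) (g k) by have [] := gP k.
have g_cvg w := near_dist_cvg (y := w) f_cvg g_near.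
have lhs_cvg : f (g k ybar) - f (g k y) @[k --> \oo] -->
    f (mdist (z s) ybar) - f (mdist (z s) y) by exact: cvgB.
have rhs_cvg : (1 - s) * (f (g0 k ybar) - f (g0 k y)) +
      s * (f (g1 k ybar) - f (g1 k y)) @[k --> \oo] -->
    (1 - s) * (f (mdist z0 ybar) - f (mdist z0 y)) +
      s * (f (mdist z1 ybar) - f (mdist z1 y)).
  by apply: cvgD; apply: cvgM; do ?[exact: cvg_cst|exact: cvgB].
apply: (ler_cvg_to lhs_cvg rhs_cvg).
by exists 0%N => // k _; have [] := gP k.
Qed.
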